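(* Every LCA $(A,\rho,\mathbb{B})$ has a unique (up to equivalence) LCA-completion.
   Context: Boolean algebras may be degenerate ($0=1$ allowed); the complement of $a$ is written $a^*$. A contact relation on a Boolean algebra $A$ is a binary relation $\rho$ such that: $a\neq 0$ implies $a\rho a$; $a\rho b$ implies $a\ne 0$ and $b\neq 0$; $a\rho b$ implies $b\rho a$; $a\rho(b\vee c)$ iff ($a\rho b$ or $a\rho c$). Write $a\ll_\rho b$ iff not $a\,\rho\, b^*$. A local contact algebra (LCA) is a triple $(A,\rho,\mathbb{B})$ where $A$ is a Boolean algebra, $\rho$ is a contact relation on $A$ and $\mathbb{B}$ is an ideal of $A$ (possibly $\mathbb B=A$) such that (BC1) if $a\in\mathbb{B}$, $c\in A$ and $a\ll_\rho c$ then $a\ll_\rho b\ll_\rho c$ for some $b\in\mathbb{B}$; (BC2) if $a\rho b$ then there is $c\in\mathbb{B}$ with $a\rho(c\wedge b)$; (BC3) if $a\neq 0$ then there is $b\in\mathbb{B}\setminus\{0\}$ with $b\ll_\rho a$. A CLCA is an LCA $(A,\rho,\mathbb{B})$ with $A$ a complete Boolean algebra. An LCA-embedding $\varphi:(A,\rho,\mathbb{B})\to(A',\rho',\mathbb{B}')$ is an injective Boolean homomorphism $\varphi:A\to A'$ such that for all $a,b\in A$: $a\rho b$ iff $\varphi(a)\rho'\varphi(b)$, and $a\in\mathbb{B}$ iff $\varphi(a)\in\mathbb{B}'$. An LCA-isomorphism is a bijective LCA-embedding. A subset $\mathcal{B}\subseteq\mathbb{B}$ is dV-dense in an LCA $(A,\rho,\mathbb{B})$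 if for all $a,c\in\mathbb{B}$ with $a\ll_\rho c$ there is $b\in\mathcal{B}$ with $a\le b\le c$. An LCA-completion of an LCA $(A,\rho,\mathbb{B})$ is a pair $(\varphi,(A',\rho',\mathbb{B}'))$ where $(A',\rho',\mathbb{B}')$ is a CLCA, $\varphi$ is an LCA-embedding of $(A,\rho,\mathbb{B})$ in $(A',\rho',\mathbb{B}')$ and $\varphi(\mathbb{B})$ is a dV-dense subset of $(A',\rho',\mathbb{B}')$. Two LCA-completions $(\varphi,(A',\rho',\mathbb{B}'))$ and $(\psi,(A'',\rho'',\mathbb{B}''))$ of $(A,\rho,\mathbb{B})$ are equivalent if there is an LCA-isomorphism $\eta:(A',\rho',\mathbb{B}')\to(A'',\rho'',\mathbb{B}'')$ with $\psi=\eta\circ\varphi$. *)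

(* Defs.v *)
(* Boolean algebras are [ctbDistrLatticeType]s, for which \bot = \top is
   allowed; the complement a^* is written ~` a. *)
From HB Require Import structures.
From mathcomp Require Import all_boot all_order.
From mathcomp Require Import boolp classical_sets.

Set Implicit Arguments.
Unset Strict Implicit.
Unset Printing Implicit Defensive.

Import Order.Theory.
Local Open Scope classical_set_scope.
(* Opened last, so that `|`, `&` and ~` are the lattice operations. *)
Local Open Scope order_scope.

Definition well_below d (A : ctbDistrLatticeType d) (rho : A -> A -> Prop)
  (a b : A) : Prop := ~ rho a (~` b).

Record is_contact d (A : ctbDistrLatticeType d) (rho : A -> A -> Prop) : Prop :=
  IsContact {
    contact_refl : forall a, a <> \bot -> rho a a;
    contact_neq0 : forall a b, rho a b -> a <> \bot /\ b <> \bot;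
    contact_sym : forall a b, rho a b -> rho b a;
    contact_join : forall a b c, rho a (b `|` c) <-> rho a b \/ rho a c }.

Record is_ideal d (A : ctbDistrLatticeType d) (B : set A) : Prop := IsIdeal {
  ideal_bot : B \bot;
  ideal_join : forall a b, B a -> B b -> B (a `|` b);
  ideal_le : forall a b, a <= b -> B b -> B a }.

Record lca (d : Order.disp_t) := LCA {
  lca_alg :> ctbDistrLatticeType d;
  contact : lca_alg -> lca_alg -> Prop;
  bounded : set lca_alg;
  contactP : is_contact contact;
  boundedP : is_ideal bounded;
  lca_BC1 : forall a c, bounded a -> well_below contact a c ->
    exists b, [/\ bounded b, well_below contact a b & well_below contact b c];
  lca_BC2 : forall a b, contact a b ->
    exists c, bounded c /\ contact a (c `&` b);
  lca_BC3 : forall a, a <> \bot ->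
    exists b, [/\ bounded b, b <> \bot & well_below contact b a] }.

Arguments contact {d l}.
Arguments bounded {d l}.

Definition complete_boolean d (A : ctbDistrLatticeType d) : Prop :=
  forall S : set A, supremums S !=set0.

Definition is_clca d (X : lca d) : Prop := complete_boolean X.

(* Not [{tblmorphism A -> A'}], which only asks for preservation of \bot and
   \top. *)
Record is_boolean_morphism d d' (A : ctbDistrLatticeType d)
  (A' : ctbDistrLatticeType d') (f : A -> A') : Prop := IsBooleanMorphism {
    bmorphI : {morph f : a b / a `&` b};
    bmorphU : {morph f : a b / a `|` b};
    bmorphC : {morph f : a / ~` a};
    bmorph0 : f \bot = \bot;
    bmorph1 : f \top = \top }.

Definition is_lca_embedding d d' (X : lca d) (X' : lca d')
  (f : X -> X') : Prop :=
  [/\ is_boolean_morphism f,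
      injective f,
      forall a b, contact a b <-> contact (f a) (f b)
    & forall a, bounded a <-> bounded (f a)].

Definition is_lca_isomorphism d d' (X : lca d) (X' : lca d')
  (f : X -> X') : Prop :=
  is_lca_embedding f /\ bijective f.

Definition dV_dense d (X : lca d) (S : set X) : Prop :=
  S `<=` bounded /\
  forall a c : X, bounded a -> bounded c -> well_below contact a c ->
    exists b, [/\ S b, a <= b & b <= c].

Record lca_completion d (X : lca d) d' := LCACompletion {
  completion_lca :> lca d';
  completion_map : X -> completion_lca;
  completion_clca : is_clca completion_lca;
  completion_embedding : is_lca_embedding completion_map;
  completion_dense : dV_dense (completion_map @` bounded) }.

Definition equiv_completions d (X : lca d) d1 d2
  (C1 : lca_completion X d1) (C2 : lca_completion X d2) : Prop :=
  exists eta : C1 -> C2,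
    is_lca_isomorphism eta /\ forall a, completion_map C2 a = eta (completion_map C1 a).

(* Main.v *)
(* A completion of (A, rho, B) is the Dedekind-MacNeille completion phi : A -> A'
   of the Boolean algebra A, with B' the ideal generated by phi(B); two bounded
   elements of A' are in contact iff all their upper bounds from A are, and two
   arbitrary ones iff some bounded parts of them are.  For existence, A' is
   realised as the algebra of regular ideals of A.  For uniqueness, BC1 and
   dV-density put, between any a' << c' with a' bounded, some phi a << phi b with
   a and b bounded; with BC3 this makes phi(A) dense in A', and it determines
   B' and, with BC2, rho'. *)
Require Import Defs.
From HB Require Import structures.
From mathcomp Require Import all_boot all_order.
From mathcomp Require Import boolp classical_sets.

Set Implicit Arguments.
Unset Strict Implicit.
Unset Printing Implicit Defensive.

Import Order.Theory.
Local Open Scope classical_set_scope.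
Local Open Scope order_scope.

(** * Boolean homomorphisms and order isomorphisms *)

Section BooleanMorphisms.
Context {d1 d2 : Order.disp_t} {A : ctbDistrLatticeType d1}
  {B : ctbDistrLatticeType d2}.

Lemma boolean_morphismIC (f : A -> B) :
  {morph f : a b / a `&` b} -> {morph f : a / ~` a} -> is_boolean_morphism f.
Proof.
move=> fI fC.
have fU : {morph f : a b / a `|` b}.
  by move=> a b; rewrite -[a `|` b]complK complU fC fI !fC -complU complK.
have f0 : f \bot = \bot by rewrite -{1}(meetxC \bot) fI fC meetxC.
by split=> //; rewrite -compl0 fC f0 compl0.
Qed.

Lemma boolean_morphism_mono (f : A -> B) :
  is_boolean_morphism f -> injective f -> {mono f : a b / a <= b}.
Proof.
by move=> fB fI a b; rewrite !leEmeet -(bmorphI fB) (inj_eq fI).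
Qed.

(** Meets are preserved because [f] is right adjoint to its inverse [g]. A complement is the largest
    element disjoint from the given one, which depends on meets and order only. *)
Lemma order_iso_boolean_morphism (f : A -> B) (g : B -> A) :
  {mono f : a b / a <= b} -> cancel g f -> is_boolean_morphism f.
Proof.
move=> fM gK.
have adj y a : (y <= f a) = (g y <= a) by rewrite -fM gK.
have f0 : f \bot = \bot.
  by apply/le_anti; rewrite le0x andbT -[\bot in leRHS]gK fM le0x.
have fI : {morph f : a b / a `&` b}.
  move=> a b; apply/le_anti.
  by rewrite lexI !fM leIl leIr adj lexI -!adj leIl leIr.
apply: boolean_morphismIC => // a; apply/le_anti.
rewrite -disj_leC -fI meetC meetxC f0 eqxx adj -disj_leC.
by rewrite -lex0 -fM fI gK f0 meetC meetxC lexx.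
Qed.

End BooleanMorphisms.

(** * Dense embeddings and uniqueness of the Dedekind-MacNeille completion *)

Section DenseMaps.
Context {d1 d2 : Order.disp_t} {A : ctbDistrLatticeType d1}
  {B : ctbDistrLatticeType d2}.
Implicit Types (x y : B).

Definition dense_map (f : A -> B) :=
  forall x, x <> \bot -> exists a, a <> \bot /\ f a <= x.

Lemma nle_neq0 d (L : ctbDistrLatticeType d) (a b : L) :
  ~~ (a <= b) -> a `&` ~` b <> \bot.
Proof. by move=> + E; rewrite -[b in a <= b]complK -disj_leC E eqxx. Qed.

(** If [x <= y] failed, the nonzero difference of [x] and [y] would contain some [f a] with [a]
    nonzero; this [f a] is below [x], hence below [y], yet disjoint from [y]. *)
Lemma dense_map_le (f : A -> B) x y :
    is_boolean_morphism f -> injective f -> dense_map f ->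
  (forall a, f a <= x -> f a <= y) -> x <= y.
Proof.
move=> fB fI fD fxy; apply: contrapT => /negP /nle_neq0 /fD[a [a0]].
rewrite lexI => /andP[/fxy ay ay']; apply: a0; apply: fI.
by rewrite (bmorph0 fB); apply/eqP; rewrite -lex0 -(meetxC y) lexI ay.
Qed.

(** The map [h] sends [x] to the supremum of all [g a] with [f a <= x]. The point is that no further
    [g a] falls below this supremum. *)
Lemma dense_map_transfer (f : A -> B) d3 (L : ctbDistrLatticeType d3)
    (g : A -> L) :
    is_boolean_morphism f -> injective f -> dense_map f ->
    is_boolean_morphism g -> injective g -> complete_boolean L ->
  exists h : B -> L, forall x a, (g a <= h x) = (f a <= x).
Proof.
move=> fB fI fD gB gI cL.
have fM := boolean_morphism_mono fB fI; have gM := boolean_morphism_mono gB gI.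
pose below x := [set g a | a in [set a | f a <= x]].
have /choice[h hP] x : exists z, supremums (below x) z by exact: cL.
exists h => x a; have [ub lub] := hP x.
apply/idP/idP => [ax|ax]; last by apply: ub; exists a.
(* A nonzero [b <= a] with [f b] disjoint from [x] exists by density. Then the complement of [g b]
   bounds the defining set of [h x], so [g b <= g a <= h x] forces [b] to vanish. *)
apply: contrapT => /negP /nle_neq0 /fD[b [b0]].
rewrite lexI fM => /andP[ba bx].
have hb : h x <= ~` g b.
  apply: lub => _ [c /= cx <-]; rewrite -(bmorphC gB) gM -fM (bmorphC fB).
  by rewrite (le_trans cx) // lexC.
apply: b0; apply: gI.
rewrite (bmorph0 gB); apply/eqP; rewrite -lex0 -(meetxC (g b)) lexI lexx.
by rewrite (le_trans _ hb) // (le_trans _ ax) // gM.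
Qed.

End DenseMaps.

(** By density, an element of [B1] or [B2] is determined by the elements of [A] whose images lie
    below it. The transfer maps in the two directions preserve these sets, so they are mutually
    inverse. *)
Lemma dense_completion_iso d d1 d2 (A : ctbDistrLatticeType d)
    (B1 : ctbDistrLatticeType d1) (B2 : ctbDistrLatticeType d2)
    (f1 : A -> B1) (f2 : A -> B2) :
    is_boolean_morphism f1 -> injective f1 -> dense_map f1 ->
    complete_boolean B1 ->
    is_boolean_morphism f2 -> injective f2 -> dense_map f2 ->
    complete_boolean B2 ->
  exists (h : B1 -> B2) (g : B2 -> B1), [/\ {mono h : x y / x <= y},
    cancel h g, cancel g h & forall a, h (f1 a) = f2 a].
Proof.
move=> B1P I1 D1 c1 B2P I2 D2 c2.
have [h hE] := dense_map_transfer B1P I1 D1 B2P I2 c2.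
have [g gE] := dense_map_transfer B2P I2 D2 B1P I1 c1.
have ext1 x y : (forall a, (f1 a <= x) = (f1 a <= y)) -> x = y.
  by move=> xy; apply/le_anti/andP; split;
    apply: (dense_map_le B1P I1 D1) => a; rewrite xy.
have ext2 x y : (forall a, (f2 a <= x) = (f2 a <= y)) -> x = y.
  by move=> xy; apply/le_anti/andP; split;
    apply: (dense_map_le B2P I2 D2) => a; rewrite xy.
exists h, g; split.
- move=> x y; apply/idP/idP => xy.
    apply: (dense_map_le B1P I1 D1) => a; rewrite -!hE => ax.
    exact: le_trans xy.
  apply: (dense_map_le B2P I2 D2) => a; rewrite !hE => ax.
  exact: le_trans xy.
- by move=> x; apply: ext1 => a; rewrite gE hE.
- by move=> x; apply: ext2 => a; rewrite hE gE.
- move=> a; apply: ext2 => b; rewrite hE.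
  by rewrite (boolean_morphism_mono B1P I1) (boolean_morphism_mono B2P I2).
Qed.

(** * The complete Boolean algebra of regular ideals *)

Section RegularIdeals.
Context {d : Order.disp_t} {A : ctbDistrLatticeType d}.
Implicit Types (S T : set A) (a b x y : A).

(** This is the annihilator of [S]; it is an antitone Galois connection with itself, so
    [perp (perp S)] is a closure operator. *)
Definition perp S : set A := [set x | forall s, S s -> x `&` s = \bot].

Lemma perpS S T : S `<=` T -> perp T `<=` perp S.
Proof. by move=> ST x xT s /ST; apply: xT. Qed.

Lemma subperpK S : S `<=` perp (perp S).
Proof. by move=> x Sx s /(_ x Sx); rewrite meetC. Qed.

Lemma perp3 S : perp (perp (perp S)) = perp S.
Proof. by apply/seteqP; split; [exact/perpS/subperpK | exact: subperpK]. Qed.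

Lemma perp_le S x y : x <= y -> perp S y -> perp S x.
Proof.
move=> xy Sy s /Sy E; apply/eqP; rewrite -lex0 -E.
exact: leI2.
Qed.

Record regular_ideal := RegularIdeal {
  rideal_set :> set A;
  ridealK : perp (perp rideal_set) = rideal_set }.
Implicit Types (I J K : regular_ideal).

Lemma rideal_inj I J : (I : set A) = J -> I = J.
Proof.
case: I J => [S SK] [T TK] /= ST; case: _ / ST TK => TK.
by congr RegularIdeal; exact: Prop_irrelevance.
Qed.

Lemma rideal_le I x y : x <= y -> (I : set A) y -> (I : set A) x.
Proof. by rewrite -(ridealK I); exact: perp_le. Qed.

Lemma rideal0 I : (I : set A) \bot.
Proof. by rewrite -(ridealK I) => s _; rewrite meet0x. Qed.

Definition perp_rideal S := RegularIdeal (perp3 S).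

Lemma setI_ridealK I J : perp (perp (I `&` J)%classic) = (I `&` J)%classic.
Proof.
apply/seteqP; split=> [|]; last exact: subperpK.
move=> x xIJ; split; [rewrite -(ridealK I) | rewrite -(ridealK J)];
  by apply: perpS xIJ; apply: perpS => y [].
Qed.

Definition rideal_meet I J := RegularIdeal (setI_ridealK I J).
Definition rideal_sup S := perp_rideal (perp S).
Definition rideal_join I J := rideal_sup (I `|` J)%classic.

Lemma rideal_sup_le S I : (rideal_sup S `<=` I) <-> (S `<=` I).
Proof.
split=> SI; first by apply: subset_trans SI; exact: subperpK.
by rewrite -(ridealK I); apply/perpS/perpS.
Qed.

HB.instance Definition _ := gen_eqMixin regular_ideal.
HB.instance Definition _ := gen_choiceMixin regular_ideal.

Definition rideal_leb I J : bool := `[< I `<=` J >].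

Fact rideal_leb_refl : reflexive rideal_leb.
Proof. by move=> I; apply/asboolP. Qed.

Fact rideal_leb_anti : antisymmetric rideal_leb.
Proof.
move=> I J /andP[/asboolP IJ /asboolP JI].
by apply: rideal_inj; apply/seteqP.
Qed.

Fact rideal_leb_trans : transitive rideal_leb.
Proof.
move=> J I K /asboolP IJ /asboolP JK; apply/asboolP.
exact: subset_trans JK.
Qed.

HB.instance Definition _ := Order.Le_isPOrder.Build d regular_ideal
  rideal_leb_refl rideal_leb_anti rideal_leb_trans.

Lemma rideal_leP I J : reflect (I `<=` J) (I <= J).
Proof. exact: asboolP. Qed.

Fact rideal_lexI I J K : (I <= rideal_meet J K) = (I <= J) && (I <= K).
Proof.
apply/rideal_leP/andP => [IJK|[/rideal_leP IJ /rideal_leP IK] x Ix].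
  by split; apply/rideal_leP => x /IJK[].
by split; [exact: IJ | exact: IK].
Qed.

Fact rideal_leUx I J K : (rideal_join I J <= K) = (I <= K) && (J <= K).
Proof.
apply/rideal_leP/andP => [/rideal_sup_le IJK|[/rideal_leP IK /rideal_leP JK]].
  by split; apply/rideal_leP => x ?; apply: IJK; [left|right].
by apply/rideal_sup_le => x [/IK|/JK].
Qed.

HB.instance Definition _ := Order.POrder_MeetJoin_isLattice.Build d
  regular_ideal rideal_lexI rideal_leUx.

(** For [x] in the left side and [y] annihilating both [I] meet [K] and [J] meet [K], the element
    [x] meet [y] annihilates [I] and [J]. Since [x] is in their double annihilator, [x] is disjoint
    from [x] meet [y], hence from [y]. *)
Fact rideal_meetUl :
  left_distributive (@Order.meet d regular_ideal) (@Order.join d regular_ideal).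
Proof.
move=> I J K; apply/le_anti/andP; split; last first.
  by rewrite leUx !leI2 ?leUl ?leUr.
apply/rideal_leP.
change ((rideal_join I J `&` K)%classic `<=`
  rideal_join (rideal_meet I K) (rideal_meet J K)) => x [xIJ Kx] y yIJK.
(* Stated for a down-closed [L] to treat [I] and [J] alike: for [s] in [L], the element [x] meet [s]
   lies in both [L] and [K], so [y] annihilates it. *)
have yx (L : set A) :
    (forall z, L z -> rideal_set K z -> ((I `&` K) `|` (J `&` K))%classic z) ->
    (forall z s, L z -> s <= z -> L s) -> perp L (x `&` y).
  move=> LIJK Lle s Ls; rewrite (meetC x) -meetA; apply: yIJK.
  by apply: LIJK; [apply: Lle Ls _; exact: leIr | apply: rideal_le Kx; exact: leIl].
have {}yx : perp (I `|` J)%classic (x `&` y).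
  move=> s [Is|Js].
    by apply: (yx I) => // [z Iz Kz|z t Iz tz]; [left | exact: rideal_le Iz].
  by apply: (yx J) => // [z Iz Kz|z t Iz tz]; [right | exact: rideal_le Iz].
by have := xIJ _ yx; rewrite meetA meetxx.
Qed.

HB.instance Definition _ :=
  Order.Lattice_Meet_isDistrLattice.Build d regular_ideal rideal_meetUl.

Definition rideal_bot := perp_rideal setT.
Definition rideal_top := perp_rideal set0.

Lemma rideal_botE x : (rideal_bot : set A) x -> x = \bot.
Proof. by move/(_ x I); rewrite meetxx. Qed.

Fact rideal_le0x I : rideal_bot <= I.
Proof. by apply/rideal_leP => x /rideal_botE ->; exact: rideal0. Qed.

Fact rideal_lex1 I : I <= rideal_top.
Proof. by apply/rideal_leP => x _ s. Qed.

HB.instance Definition _ := Order.hasBottom.Build d regular_ideal rideal_le0x.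
HB.instance Definition _ := Order.hasTop.Build d regular_ideal rideal_lex1.

Fact rideal_meetxC I : I `&` perp_rideal I = \bot.
Proof.
apply/eqP; rewrite -lex0; apply/rideal_leP => x [Ix /(_ x Ix)].
by rewrite meetxx => ->; exact: rideal0.
Qed.

Fact rideal_joinxC I : I `|` perp_rideal I = \top.
Proof.
apply/eqP; rewrite -le1x; apply/rideal_leP.
change (rideal_top `<=` rideal_join I (perp_rideal I)) => x _ y yI.
have yI' : perp I y by move=> s Is; apply: yI; left.
by have := yI y (or_intror yI'); rewrite meetxx => ->; rewrite meetx0.
Qed.

HB.instance Definition _ := Order.TBDistrLattice_hasComplement.Build d
  regular_ideal rideal_joinxC rideal_meetxC.

Lemma regular_ideal_complete : complete_boolean regular_ideal.
Proof.
move=> F; exists (rideal_sup [set x | exists2 I, F I & (I : set A) x]); split.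
  by move=> I FI; apply/rideal_leP => x Ix; apply: subperpK; exists I.
move=> J FJ; apply/rideal_leP/rideal_sup_le => x [I FI Ix].
by have /rideal_leP := FJ I FI; apply.
Qed.

Lemma perp_le_compl a : perp [set x | x <= a] = [set x | x <= ~` a].
Proof.
apply/seteqP; split=> x /=.
  by move=> /(_ a (lexx a)) E; rewrite -disj_leC E.
move=> xa s sa; apply/eqP; rewrite disj_leC (le_trans xa) //.
by rewrite leC.
Qed.

Fact principalK a : perp (perp [set x | x <= a]) = [set x | x <= a].
Proof. by rewrite !perp_le_compl complK. Qed.

Definition principal a := RegularIdeal (principalK a).

Lemma principal_le a I : principal a <= I <-> (I : set A) a.
Proof.
split=> [/rideal_leP aI|Ia]; first exact: aI a (lexx a).
by apply/rideal_leP => x xa; exact: rideal_le Ia.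
Qed.

Lemma principal_boolean_morphism : is_boolean_morphism principal.
Proof.
apply: boolean_morphismIC => [a b|a]; apply: rideal_inj.
  by apply/seteqP; split=> x /=; [rewrite lexI => /andP | move/andP; rewrite -lexI].
by rewrite /= perp_le_compl.
Qed.

Lemma principal_inj : injective principal.
Proof.
move=> a b /(congr1 rideal_set)/seteqP[ab ba]; apply/le_anti/andP.
by split; [apply: ab | apply: ba]; rewrite /=.
Qed.

Lemma principal_dense : dense_map principal.
Proof.
move=> I I0; apply: contrapT => nI; apply: I0; apply/eqP; rewrite -lex0.
apply/rideal_leP => a Ia; have [->|/eqP a0] := eqVneq a \bot; first exact: rideal0.
by case: nI; exists a; split=> //; apply/principal_le.
Qed.

End RegularIdeals.
Arguments regular_ideal {d} A.

(** * Elementary properties of contact and of the well-below relation *)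

Section Contact.
Context {d : Order.disp_t} {A : ctbDistrLatticeType d} {rho : A -> A -> Prop}.
Hypothesis rhoP : is_contact rho.
Implicit Types (a b c : A).

Lemma contact_le a a' b b' : a <= a' -> b <= b' -> rho a b -> rho a' b'.
Proof.
have mono u v w : v <= w -> rho u v -> rho u w.
  by move=> /join_r <- uv; apply/(contact_join rhoP); left.
move=> aa' bb' /(mono _ _ _ bb') /(contact_sym rhoP) /(mono _ _ _ aa').
exact: contact_sym.
Qed.

Lemma well_below_le a b : well_below rho a b -> a <= b.
Proof.
move=> ab; apply: contrapT => /negP /nle_neq0 /(contact_refl rhoP) c.
by apply: ab; apply: contact_le c; [exact: leIl | exact: leIr].
Qed.

Lemma well_below_sub a' a b b' :
  a' <= a -> b <= b' -> well_below rho a b -> well_below rho a' b'.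
Proof. by move=> a'a bb' ab c; apply: ab; apply: contact_le c; rewrite ?leC. Qed.

Lemma well_below_top a : well_below rho a \top.
Proof. by rewrite /well_below compl1 => /(contact_neq0 rhoP)[]. Qed.

Lemma well_belowI a b c :
  well_below rho a b -> well_below rho a c -> well_below rho a (b `&` c).
Proof. by move=> ab ac; rewrite /well_below complI => /(contact_join rhoP)[]. Qed.

End Contact.

(** * Extending the LCA structure along a dense Boolean embedding *)

Section Extension.
Context {d d' : Order.disp_t} {X : lca d} {A : ctbDistrLatticeType d'}.
Variable phi : X -> A.
Implicit Types (a b : X) (x y z u v : A).

Definition ext_bounded : set A := [set x | exists2 b, bounded b & x <= phi b].

Definition near u v := forall a b, u <= phi a -> v <= phi b -> contact a b.

(** Passing to bounded parts [u] and [v] builds BC2 into the definition; on bounded elements the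
    relation is just [near]. *)
Definition ext_contact x y := exists u v,
  [/\ ext_bounded u, ext_bounded v, u <= x, v <= y & near u v].

Lemma ext_bounded_le x y : x <= y -> ext_bounded y -> ext_bounded x.
Proof. by move=> xy [b Bb yb]; exists b => //; exact: le_trans yb. Qed.

Lemma near_sym u v : near u v -> near v u.
Proof. by move=> uv a b va ub; apply: (contact_sym (contactP X)); exact: uv. Qed.

Lemma ext_contact_le x x' y y' :
  x <= x' -> y <= y' -> ext_contact x y -> ext_contact x' y'.
Proof.
move=> xx' yy' [u [v [Bu Bv ux vy uv]]]; exists u, v.
by split=> //; [exact: le_trans xx' | exact: le_trans yy'].
Qed.

Lemma ext_contact_near x y : ext_bounded x -> ext_bounded y ->
  ext_contact x y <-> near x y.
Proof.
move=> Bx By; split=> [[u [v [_ _ ux vy uv]]] a b xa yb|xy]; last by exists x, y.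
by apply: uv; [exact: le_trans xa | exact: le_trans yb].
Qed.

Hypotheses (phiB : is_boolean_morphism phi) (phi_inj : injective phi)
  (phiD : dense_map phi).

Let phiM := boolean_morphism_mono phiB phi_inj.

Fact ext_bounded_ideal : is_ideal ext_bounded.
Proof.
split; first by exists \bot; [exact: ideal_bot (boundedP X) | exact: le0x].
  move=> x y [b Bb xb] [c Bc yc]; exists (b `|` c).
    exact: ideal_join (boundedP X) _ _ Bb Bc.
  by rewrite (bmorphU phiB) leU2.
exact: ext_bounded_le.
Qed.

Lemma bounded_dense x : x <> \bot ->
  exists b, [/\ bounded b, b <> \bot & phi b <= x].
Proof.
move=> /phiD[a [/lca_BC3[b [Bb b0 ba]] ax]]; exists b; split=> //.
by rewrite (le_trans _ ax) // phiM (well_below_le (contactP X)).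
Qed.

Lemma near_neq0 u v : near u v -> u <> \bot.
Proof.
move=> uv u0; have/(contact_neq0 (contactP X))[] // : contact (\bot : X) \top.
by apply: uv; rewrite ?u0 ?le0x // (bmorph1 phiB) lex1.
Qed.

(** If [a], [b] witness that [u] is not near [v], and [a'], [c] that it is not near [w], then the
    meet of [a] and [a'] and the join of [b] and [c] are upper bounds of [u] and of [v] join [w]
    that are not in contact. *)
Lemma near_join u v w : near u (v `|` w) -> near u v \/ near u w.
Proof.
move=> uvw; apply: contrapT => /not_orP[].
move=> /existsNP[a /existsNP[b /not_implyP[ua /not_implyP[vb nab]]]].
move=> /existsNP[a' /existsNP[c /not_implyP[ua' /not_implyP[wc nac]]]].
have /(contact_join (contactP X))[] : contact (a `&` a') (b `|` c).
- by apply: uvw; rewrite ?(bmorphI phiB) ?(bmorphU phiB) ?lexI ?ua ?ua' // leU2.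
- by move/(contact_le (contactP X) (leIl _ _) (lexx _)).
- by move/(contact_le (contactP X) (leIr _ _) (lexx _)).
Qed.

Fact ext_contact_contact : is_contact ext_contact.
Proof.
split.
- move=> x /bounded_dense[b [Bb b0 bx]].
  apply: (ext_contact_le bx bx); exists (phi b), (phi b).
  have Bpb : ext_bounded (phi b) by exists b.
  split=> // a c; rewrite !phiM => ba bc.
  exact: contact_le (contactP X) _ _ _ _ ba bc (contact_refl (contactP X) b0).
- move=> x y [u [v [_ _ ux vy uv]]]; split=> E.
    by apply: (near_neq0 uv); apply/eqP; rewrite -lex0 -E.
  by apply: (near_neq0 (near_sym uv)); apply/eqP; rewrite -lex0 -E.
- by move=> x y [u [v [Bu Bv ux vy uv]]]; exists v, u; split=> //; exact: near_sym.
- move=> x y z; split=> [[u [v [Bu Bv ux vyz]]]|[]]; last 2 first.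
  + by apply: ext_contact_le => //; exact: leUl.
  + by apply: ext_contact_le => //; exact: leUr.
  (* Being below [y] join [z], the part [v] splits into its meets with [y] and with [z]. *)
  rewrite -(meet_l vyz) meetUr => /near_join[] n; [left|right];
    exists u; [exists (v `&` y)|exists (v `&` z)];
    by split=> //; [exact: ext_bounded_le (leIl _ _) Bv | exact: leIr].
Qed.

Lemma ext_contactE a b : contact a b <-> ext_contact (phi a) (phi b).
Proof.
split=> [|[u [v [[a1 Ba1 ua1] [b1 Bb1 vb1] ua vb uv]]]].
  (* BC2, used once on each side, replaces [a] and [b] by bounded parts still in contact. *)
  move=> /lca_BC2[c [Bc /(contact_sym (contactP X))]].
  move=> /lca_BC2[e [Be /(contact_sym (contactP X)) ec]].
  exists (phi (e `&` a)), (phi (c `&` b)); rewrite !phiM !leIr; split=> //.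
  - by exists e; rewrite // phiM leIl.
  - by exists c; rewrite // phiM leIl.
  - by move=> a' b'; rewrite !phiM => ea cb;
    exact: contact_le (contactP X) _ _ _ _ ea cb ec.
exact: uv.
Qed.

Lemma ext_boundedE a : bounded a <-> ext_bounded (phi a).
Proof.
split=> [Ba|[b Bb]]; first by exists a.
by rewrite phiM => ab; exact: ideal_le (boundedP X) _ _ ab Bb.
Qed.

Lemma ext_well_belowE a b :
  well_below contact a b <-> well_below ext_contact (phi a) (phi b).
Proof. by rewrite /well_below -(bmorphC phiB); split=> h /ext_contactE. Qed.

(** Everything about the extended well-below relation reduces through this lemma to the original
    one: it yields BC1 and dV-density. *)
Lemma ext_well_below_interpolation x z :
  ext_bounded x -> well_below ext_contact x z -> exists a c,
    [/\ bounded a, bounded c, x <= phi a, well_below contact a c & phi c <= z].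
Proof.
move=> [a0 Ba0 xa0] xz.
(* The bounded [e] cuts the possibly unbounded complement of [z] down to a bounded part, where
   non-contact with [x] has witnesses in [X]. *)
have [e [Be a0e _]] := lca_BC1 Ba0 (@well_below_top _ _ _ (contactP X) a0).
have Bx : ext_bounded x by exists a0.
have Bze : ext_bounded (~` z `&` phi e) by exists e; rewrite ?leIr.
have : ~ near x (~` z `&` phi e).
  move=> n; apply: xz; apply: (ext_contact_le (lexx x) (leIl _ (phi e))).
  exact/ext_contact_near.
move=> /existsNP[a /existsNP[b /not_implyP[xa /not_implyP[zeb nab]]]].
(* The first element is well below the complement of [b] because [a] and [b] are not in contact, and
   below [e] because [a0] is. As [phi b] covers the part of the complement of [z] inside [phi e],
   the image of the second element lies below [z]. *)
exists (a0 `&` a), (~` b `&` e); split.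
- exact: ideal_le (boundedP X) _ _ (leIl _ _) Ba0.
- exact: ideal_le (boundedP X) _ _ (leIr _ _) Be.
- by rewrite (bmorphI phiB) lexI xa0.
- apply: (well_belowI (contactP X)).
    by move/(contact_le (contactP X) (leIr _ _) (lexx _)); rewrite complK.
  exact: well_below_sub (contactP X) _ _ _ _ (leIl _ _) (lexx _) a0e.
- rewrite (bmorphI phiB) (bmorphC phiB) -[z]complK -disj_leC.
  by rewrite -meetA meetC disj_leC complK [_ e `&` _]meetC.
Qed.

Fact ext_BC1 x z : ext_bounded x -> well_below ext_contact x z ->
  exists y, [/\ ext_bounded y, well_below ext_contact x y
              & well_below ext_contact y z].
Proof.
move=> Bx /(ext_well_below_interpolation Bx)[a [c [Ba Bc xa ac cz]]].
have [b [Bb ab bc]] := lca_BC1 Ba ac.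
exists (phi b); split; first exact/ext_boundedE.
  apply: (well_below_sub ext_contact_contact xa (lexx _)).
  exact/ext_well_belowE.
apply: (well_below_sub ext_contact_contact (lexx _) cz).
exact/ext_well_belowE.
Qed.

Fact ext_BC2 x y : ext_contact x y ->
  exists z, ext_bounded z /\ ext_contact x (z `&` y).
Proof.
move=> [u [v [Bu Bv ux vy uv]]]; exists v; split=> //; exists u, v.
by rewrite lexI lexx.
Qed.

Fact ext_BC3 x : x <> \bot ->
  exists y, [/\ ext_bounded y, y <> \bot & well_below ext_contact y x].
Proof.
move=> /phiD[a [/lca_BC3[b [Bb b0 ba]] ax]]; exists (phi b); split.
- exact/ext_boundedE.
- by rewrite -(bmorph0 phiB) => /phi_inj.
- apply: (well_below_sub ext_contact_contact (lexx _) ax).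
  exact/ext_well_belowE.
Qed.

Definition ext_lca : lca d' :=
  LCA ext_contact_contact ext_bounded_ideal ext_BC1 ext_BC2 ext_BC3.

Lemma ext_lca_embedding : is_lca_embedding (phi : X -> ext_lca).
Proof. by split=> //; [exact: ext_contactE | exact: ext_boundedE]. Qed.

Lemma ext_lca_dense : dV_dense ((phi : X -> ext_lca) @` bounded).
Proof.
split=> [_ [a Ba <-]|x z Bx _]; first by exists a.
move=> /(ext_well_below_interpolation Bx)[a [c [Ba Bc xa ac cz]]].
exists (phi a); split=> //.
by rewrite (le_trans _ cz) // phiM (well_below_le (contactP X)).
Qed.

End Extension.

Theorem lca_completion_exists d (X : lca d) : inhabited (lca_completion X d).
Proof.
have phiB := @principal_boolean_morphism _ X.
have phiI := @principal_inj _ X; have phiD := @principal_dense _ X.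
exact: (inhabits (@LCACompletion _ X _ (ext_lca phiB phiI phiD) principal
  (@regular_ideal_complete _ X) (ext_lca_embedding phiB phiI phiD)
  (ext_lca_dense phiB phiI phiD))).
Qed.

(** * An arbitrary completion is determined by its dense embedding *)

Section CompletionStructure.
Context {d d' : Order.disp_t} {X : lca d} (C : lca_completion X d').
Local Notation phi := (completion_map C).
Implicit Types (a b : X) (x y z : C).

Lemma completion_morphism : is_boolean_morphism phi.
Proof. by case: (completion_embedding C). Qed.

Lemma completion_inj : injective phi.
Proof. by case: (completion_embedding C). Qed.

Lemma completion_mono : {mono phi : a b / a <= b}.
Proof. exact: boolean_morphism_mono completion_morphism completion_inj. Qed.

Lemma completion_contact a b : contact a b <-> contact (phi a) (phi b).
Proof. by case: (completion_embedding C). Qed.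

Lemma completion_bounded a : bounded a <-> bounded (phi a).
Proof. by case: (completion_embedding C). Qed.

Lemma completion_well_below a b :
  well_below contact a b <-> well_below contact (phi a) (phi b).
Proof.
rewrite /well_below -(bmorphC completion_morphism).
by split=> h /completion_contact.
Qed.

Lemma completion_interpolation x z : bounded x -> well_below contact x z ->
  exists a c,
    [/\ bounded a, bounded c, x <= phi a, well_below contact a c & phi c <= z].
Proof.
(* Three uses of BC1 give the chain of well-below relations [x], [x'], [y], [y'], [z]. By dV-density
   [phi a] fits between [x] and [x'], and [phi c] between [y] and [y']; the middle link then gives
   [a] well below [c]. *)
move=> Bx /(lca_BC1 Bx)[y [By /(lca_BC1 Bx)[x' [Bx' xx' x'y]] yz]].
have [y' [By' yy' y'z]] := lca_BC1 By yz.
have [_ dV] := completion_dense C.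
have [_ [[a Ba <-] xa ax']] := dV _ _ Bx Bx' xx'.
have [_ [[c Bc <-] yc cy']] := dV _ _ By By' yy'.
exists a, c; split=> //.
  exact/completion_well_below/(well_below_sub (contactP C) ax' yc).
exact: le_trans cy' (well_below_le (contactP C) y'z).
Qed.

Lemma completion_dense_map : dense_map phi.
Proof.
move=> x /lca_BC3[y [By y0 /(completion_interpolation By)]].
move=> [a [c [_ _ ya ac cx]]]; exists a; split.
  move=> a0; apply: y0; apply/eqP; rewrite -lex0.
  by rewrite -(bmorph0 completion_morphism) -a0.
by rewrite (le_trans _ cx) // completion_mono (well_below_le (contactP X)).
Qed.

Lemma completion_boundedE x : bounded x <-> ext_bounded phi x.
Proof.
split=> [Bx|[b /completion_bounded Bb xb]].
  (* Every element is well below [\top], so interpolation gives a bounded [a] with [x <= phi a]. *)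
  have [a [_ [Ba _ xa _ _]]] :=
    completion_interpolation Bx (@well_below_top _ _ _ (contactP C) x).
  by exists a.
exact: ideal_le (boundedP C) _ _ xb Bb.
Qed.

Lemma completion_contactE x y : contact x y <-> ext_contact phi x y.
Proof.
split=> [|[u [v [/completion_boundedE Bu /completion_boundedE Bv ux vy uv]]]].
  move=> /lca_BC2[v [Bv /(contact_sym (contactP C))]].
  move=> /lca_BC2[u [Bu /(contact_sym (contactP C)) uv]].
  exists (u `&` x), (v `&` y); rewrite !leIr; split=> //.
  - exact/completion_boundedE/(ideal_le (boundedP C) (leIl _ _) Bu).
  - exact/completion_boundedE/(ideal_le (boundedP C) (leIl _ _) Bv).
  - move=> a b ua vb; apply/completion_contact.
    exact: contact_le (contactP C) _ _ _ _ ua vb uv.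
apply: (contact_le (contactP C) ux vy); apply: contrapT => nuv.
(* If [u] and [v] were not in contact, interpolation would give [a] well below [c] with [u <= phi a]
   and [v] below the image of the complement of [c]; nearness puts [a] in contact with that
   complement, a contradiction. *)
have wuv : well_below contact u (~` v) by rewrite /well_below complK.
have [a [c [_ _ ua ac cv]]] := completion_interpolation Bu wuv.
apply: ac; apply: uv => //.
by rewrite (bmorphC completion_morphism) lexC.
Qed.

End CompletionStructure.

(** The order isomorphism over [X] comes from density and completeness. Boundedness and contact are
    expressed by the order and the images of elements of [X] alone, so it preserves and reflects
    both. *)
Theorem lca_completion_unique d d1 d2 (X : lca d) (C1 : lca_completion X d1)
  (C2 : lca_completion X d2) : equiv_completions C1 C2.
Proof.
have [eta [g [etaM etaK gK etaphi]]] := dense_completion_iso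
  (completion_morphism C1) (@completion_inj _ _ _ C1)
  (@completion_dense_map _ _ _ C1) (@completion_clca _ _ _ C1)
  (completion_morphism C2) (@completion_inj _ _ _ C2)
  (@completion_dense_map _ _ _ C2) (@completion_clca _ _ _ C2).
have etale x a : (eta x <= completion_map C2 a) = (x <= completion_map C1 a).
  by rewrite -etaphi etaM.
have etaB x : ext_bounded (completion_map C1) x <->
    ext_bounded (completion_map C2) (eta x).
  by split=> -[b Bb xb]; exists b; rewrite ?etale // -etale.
have etaN x y : near (completion_map C1) x y <->
    near (completion_map C2) (eta x) (eta y).
  by split=> xy a b xa yb; apply: xy; rewrite ?etale // -etale.
exists eta; split=> //; split; last by exists g.
split.
- exact: order_iso_boolean_morphism etaM gK.
- exact: can_inj etaK.
- move=> x y; split=> /completion_contactE[u [v [Bu Bv ux vy uv]]];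
    apply/completion_contactE.
    exists (eta u), (eta v); rewrite !etaM.
    by split=> //; [exact/etaB | exact/etaB | exact/etaN].
  exists (g u), (g v); rewrite -![g _ <= _]etaM !gK.
  by split=> //; [apply/etaB | apply/etaB | apply/etaN]; rewrite !gK.
- by move=> x; split=> /completion_boundedE/etaB/completion_boundedE.
Qed.

Theorem theorem7p3 (d : Order.disp_t) (X : lca d) :
  (exists d' : Order.disp_t, inhabited (lca_completion X d')) /\
  (forall (d1 d2 : Order.disp_t)
     (C1 : lca_completion X d1) (C2 : lca_completion X d2),
     equiv_completions C1 C2).
Proof.
split; first by exists d; exact: lca_completion_exists.
by move=> d1 d2; exact: lca_completion_unique.
Qed.
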